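(* If $T:\ell_1\to\ell_1$ is a bounded linear operator and $A\in\Gamma_+$, then $TAT^*\in\Gamma_+$ with $$\gamma_+(TAT^* )\le\gamma_+(A)\,\|T\|_{1\to1}^2.$$
   Context: Scalars are $\mathbb{R}$ or $\mathbb{C}$; $\ell_p=\ell_p(\mathbb{N})$ with standard basis $(\delta_k)$; for $x\in\ell_1\subset\ell_2$, $xx^*$ is the rank-one operator $v\mapsto\langle v,x\rangle x$. $\Gamma$ is the set of bounded self-adjoint operators $A:\ell_2\to\ell_2$ with $\langle Ax,x\rangle\ge0$ for all $x\in\ell_2$ and $\|A\|_{1,1}:=\sum_{k,l}|\langle A\delta_k,\delta_l\rangle|<\infty$. For $A\in\Gamma$, $\gamma_+(A):=\inf\{\sum_{k=1}^\infty\|x_k\|_1^2: (x_k)\subset\ell_1,\ A=\sum_{k=1}^\infty x_kx_k^*\text{ strongly}\}$ with $\inf\varnothing=\infty$, and $\Gamma_+:=\{A\in\Gamma:\gamma_+(A)<\infty\}$. Each $A\in\Gamma$ also acts as a bounded operator $\ell_\infty\to\ell_1$ by $b\mapsto\sum_kb(k)A\delta_k$; $T^*:\ell_\infty\to\ell_\infty$ is the (conjugate-transpose) adjoint of $T$, determined by $\langle T^*b,x\rangle=\langle b,Tx\rangle$ for $b\in\ell_\infty$, $x\in\ell_1$ with the pairing $\langle b,x\rangle=\sum_kb(k)\overline{x(k)}$; $TAT^*$ is the composition $\ell_\infty\to\ell_\infty\to\ell_1\to\ell_1$, regarded as an operator on $\ell_2$ by restriction to $\ell_2\subset\ell_\infty$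 and the inclusion $\ell_1\subset\ell_2$. *)

(* Defs.v *)
From HB Require Import structures.
From mathcomp Require Import all_boot all_order all_algebra.
From mathcomp Require Import ring complex.
From mathcomp Require Import all_classical all_reals all_analysis.

Set Implicit Arguments.
Unset Strict Implicit.
Unset Printing Implicit Defensive.

Import Order.TTheory GRing.Theory Num.Theory.
Import numFieldNormedType.Exports.

Local Open Scope classical_set_scope.
Local Open Scope ring_scope.

Variant scalars := RealScalars | ComplexScalars.

Definition scalar_field (R : realType) (s : scalars) : numFieldType :=
  match s with RealScalars => R | ComplexScalars => R[i] end.

Definition conjs (R : realType) (s : scalars) : scalar_field R s -> scalar_field R s :=
  match s return scalar_field R s -> scalar_field R s with
  | RealScalars => id
  | ComplexScalars => @conjc R
  end.

(* The norm of a numFieldType takes its values in that field; [modulus] is the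
   same absolute value with values in R. *)
Definition modulus (R : realType) (s : scalars) : scalar_field R s -> R :=
  match s return scalar_field R s -> R with
  | RealScalars => fun x : R => `|x|
  | ComplexScalars => @Normc.normc R
  end.

Section modulus_theory.
Context {R : realType} {s : scalars}.
Implicit Types x y : scalar_field R s.

Lemma modulus_ge0 x : 0 <= modulus x.
Proof. by case: s x => [x|[a b]]; [exact: normr_ge0|exact: sqrtr_ge0]. Qed.

Lemma modulus0 : modulus (0 : scalar_field R s) = 0.
Proof. by case: s; [exact: normr0|exact: Normc.normc0]. Qed.

Lemma modulus1 : modulus (1 : scalar_field R s) = 1.
Proof. by case: s; [exact: normr1|exact: Normc.normc1]. Qed.

Lemma modulusM x y : modulus (x * y) = modulus x * modulus y.
Proof. by case: s x y => x y; [exact: normrM|exact: Normc.normcM]. Qed.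

Lemma ler_modulusD x y : modulus (x + y) <= modulus x + modulus y.
Proof. by case: s x y => x y; [exact: ler_normD|exact: le_normcD]. Qed.

Lemma modulusE x : `|x| = (match s return R -> scalar_field R s with
  | RealScalars => id | ComplexScalars => @real_complex R end) (modulus x).
Proof. by case: s x => //= x; rewrite normc_def; case: x. Qed.

End modulus_theory.

Section norms.
Context {R : realType} {s : scalars}.
Local Notation K := (scalar_field R s).
Local Open Scope ereal_scope.
Implicit Types x y : nat -> K.

Definition norm1 x : \bar R := \sum_(k <oo) (modulus (x k))%:E.
Definition norm2 x : \bar R := sqrte (\sum_(k <oo) (modulus (x k) ^+ 2)%:E).
Definition norminf x : \bar R := ereal_sup (range (fun k => (modulus (x k))%:E)).

Lemma sqrte_lty (a : \bar R) : (sqrte a < +oo) = (a < +oo).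
Proof. by case: a => [r| |] //=; rewrite !ltry. Qed.

Lemma norm1_submod_closed : submod_closed (fun x => norm1 x < +oo).
Proof.
split=> [|a x y hx hy]; rewrite /in_mem/=.
  by rewrite /norm1 eseries0// => k _ _; rewrite modulus0.
pose f k := (modulus a)%:E * (modulus (x k))%:E + (modulus (y k))%:E.
apply: (@le_lt_trans _ _ (\sum_(k <oo) f k)).
  apply: lee_nneseries => k; first by rewrite lee_fin modulus_ge0.
  by rewrite /f -EFinM -EFinD lee_fin -modulusM ler_modulusD.
rewrite nneseriesD => [|k _ _|k _ _]; last first.
- by rewrite lee_fin modulus_ge0.
- by rewrite mule_ge0// lee_fin modulus_ge0.
rewrite nneseriesZl => [|k _]; last by rewrite lee_fin modulus_ge0.
by rewrite lte_add_pinfty// lte_mul_pinfty// lee_fin modulus_ge0.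
Qed.

Lemma norm2_submod_closed : submod_closed (fun x => norm2 x < +oo).
Proof.
split=> [|a x y]; rewrite /in_mem/= /norm2 !sqrte_lty; last move=> hx hy.
  by rewrite eseries0// => k _ _; rewrite modulus0 expr0n.
pose f k := (2 * modulus a ^+ 2)%:E * (modulus (x k) ^+ 2)%:E +
            2%:E * (modulus (y k) ^+ 2)%:E.
apply: (@le_lt_trans _ _ (\sum_(k <oo) f k)).
  apply: lee_nneseries => k; first by rewrite lee_fin sqr_ge0.
  rewrite /f -!EFinM -EFinD lee_fin -mulrA -exprMn -modulusM -mulrDr => _.
  apply: (@le_trans _ _ ((modulus (a * x k)%R + modulus (y k)) ^+ 2)%R).
    by rewrite lerXn2r ?nnegrE ?addr_ge0 ?modulus_ge0 ?ler_modulusD.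
  rewrite -subr_ge0; set u := modulus _; set v := modulus _.
  rewrite (_ : (_ - _ = (u - v) ^+ 2)%R) ?sqr_ge0//.
  by ring.
rewrite nneseriesD => [|k _ _|k _ _]; last first.
- by rewrite -EFinM lee_fin !mulr_ge0 ?modulus_ge0.
- by rewrite -EFinM lee_fin !mulr_ge0 ?modulus_ge0.
rewrite !nneseriesZl => [|k _|k _]; try by rewrite lee_fin sqr_ge0.
by rewrite lte_add_pinfty// lte_mul_pinfty// lee_fin mulr_ge0 ?sqr_ge0.
Qed.

Lemma le_modulus_norminf x k : (modulus (x k))%:E <= norminf x.
Proof. by apply: ereal_sup_ubound; exists k. Qed.

Lemma norminf_submod_closed : submod_closed (fun x => norminf x < +oo).
Proof.
split=> [|a x y hx hy]; rewrite /in_mem/=.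
  apply: (@le_lt_trans _ _ 0) => //.
  by apply: ge_ereal_sup => _ [k _ <-]; rewrite lee_fin modulus0.
apply: (@le_lt_trans _ _ ((modulus a)%:E * norminf x + norminf y)).
  apply: ge_ereal_sup => _ [k _ <-].
  apply: (@le_trans _ _ ((modulus a)%:E * (modulus (x k))%:E + (modulus (y k))%:E)).
    by rewrite -EFinM -EFinD lee_fin -modulusM ler_modulusD.
  by rewrite leeD ?le_modulus_norminf// lee_wpmul2l ?lee_fin ?modulus_ge0 ?le_modulus_norminf.
rewrite lte_add_pinfty// lte_mul_pinfty ?lee_fin ?modulus_ge0//.
Qed.

Lemma le_modulus_norm1 x k : (modulus (x k))%:E <= norm1 x.
Proof.
rewrite /norm1 (nneseriesD1 (n := k))//; last by move=> j _; rewrite lee_fin modulus_ge0.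
by rewrite leeDl// nneseries_ge0// => j _ _; rewrite lee_fin modulus_ge0.
Qed.

Lemma norm1_norm2_lty x : norm1 x < +oo -> norm2 x < +oo.
Proof.
move=> hx; rewrite /norm2 sqrte_lty.
have x1fin : norm1 x \is a fin_num.
  by rewrite ge0_fin_numE// nneseries_ge0// => j _ _; rewrite lee_fin modulus_ge0.
apply: (@le_lt_trans _ _ (\sum_(k <oo) norm1 x * (modulus (x k))%:E)).
  apply: lee_nneseries => k _; rewrite ?lee_fin ?sqr_ge0//.
  by rewrite expr2 EFinM lee_wpmul2r ?le_modulus_norm1// lee_fin modulus_ge0.
rewrite -(fineK x1fin) nneseriesZl => [|k _]; last by rewrite lee_fin modulus_ge0.
by rewrite fineK// -[X in _ * X]/(norm1 x) -(fineK x1fin) -EFinM ltry.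
Qed.

Lemma norm2_norminf_lty x : norm2 x < +oo -> norminf x < +oo.
Proof.
rewrite /norm2 sqrte_lty => hx.
apply: (@le_lt_trans _ _ (1 + \sum_(k <oo) (modulus (x k) ^+ 2)%:E)); last first.
  by rewrite lte_add_pinfty// ltry.
apply: ge_ereal_sup => _ [k _ <-].
apply: (@le_trans _ _ (1 + (modulus (x k) ^+ 2)%:E)).
  rewrite -EFinD lee_fin; set u := modulus _; have u0 : (0 <= u)%R by exact: modulus_ge0.
  have [u1|/ltW u1] := leP u 1%R; first by rewrite (le_trans u1)// lerDl sqr_ge0.
  by rewrite (@le_trans _ _ (u ^+ 2)%R) ?lerDr// expr2 ler_peMr.
rewrite leeD2l// (nneseriesD1 (n := k))//; last by move=> j _; rewrite lee_fin sqr_ge0.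
by rewrite leeDl// nneseries_ge0// => j _ _; rewrite lee_fin sqr_ge0.
Qed.

Lemma norm1_delta_lty (k : nat) : norm1 (fun j => (j == k)%:R) < +oo.
Proof.
rewrite /norm1 (nneseriesD1 (n := k))//; last by move=> j _; rewrite lee_fin modulus_ge0.
rewrite eseries_mkcond eseries0 ?adde0 ?ltry// => j _ _.
by case: ifPn => //= /negPf ->; rewrite modulus0.
Qed.

End norms.

Section ell_spaces.
Context (R : realType) (s : scalars).
Local Notation K := (scalar_field R s).
Local Open Scope ereal_scope.

Definition ell1_pred : {pred (nat -> K)} := fun x => norm1 x < +oo.
Definition ell2_pred : {pred (nat -> K)} := fun x => norm2 x < +oo.
Definition ellinf_pred : {pred (nat -> K)} := fun x => norminf x < +oo.

HB.instance Definition _ :=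
  GRing.isSubmodClosed.Build K (nat -> K) ell1_pred norm1_submod_closed.
HB.instance Definition _ :=
  GRing.isSubmodClosed.Build K (nat -> K) ell2_pred norm2_submod_closed.
HB.instance Definition _ :=
  GRing.isSubmodClosed.Build K (nat -> K) ellinf_pred norminf_submod_closed.

Record ell1 := Ell1 { ell1_seq :> nat -> K; ell1P : ell1_seq \in ell1_pred }.
Record ell2 := Ell2 { ell2_seq :> nat -> K; ell2P : ell2_seq \in ell2_pred }.
Record ellinf :=
  Ellinf { ellinf_seq :> nat -> K; ellinfP : ellinf_seq \in ellinf_pred }.

HB.instance Definition _ := [isSub for ell1_seq].
HB.instance Definition _ := [Choice of ell1 by <:].
HB.instance Definition _ := [SubChoice_isSubLmodule of ell1 by <:].
HB.instance Definition _ := [isSub for ell2_seq].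
HB.instance Definition _ := [Choice of ell2 by <:].
HB.instance Definition _ := [SubChoice_isSubLmodule of ell2 by <:].
HB.instance Definition _ := [isSub for ellinf_seq].
HB.instance Definition _ := [Choice of ellinf by <:].
HB.instance Definition _ := [SubChoice_isSubLmodule of ellinf by <:].

End ell_spaces.

Section operators.
Context {R : realType} {s : scalars}.
Local Notation K := (scalar_field R s).
Local Notation ell1 := (ell1 R s).
Local Notation ell2 := (ell2 R s).
Local Notation ellinf := (ellinf R s).

Definition ell1_ell2 (x : ell1) : ell2 := Ell2 (norm1_norm2_lty (ell1P x)).
Definition ell2_ellinf (x : ell2) : ellinf := Ellinf (norm2_norminf_lty (ell2P x)).

Definition delta1 (k : nat) : ell1 := Ell1 (norm1_delta_lty k).
Definition delta (k : nat) : ell2 := ell1_ell2 (delta1 k).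

(* Both the inner product of ell2 and the pairing of ellinf with ell1; the
   series converges absolutely in either case. *)
Definition dot (x y : nat -> K) : K :=
  limn (fun n => \sum_(0 <= k < n) x k * conjs (y k)).

Definition opnorm1 (T : ell1 -> ell1) : \bar R :=
  ereal_sup [set norm1 (T x) | x in [set x : ell1 | (norm1 x <= 1)%E]].

Definition opnorm2 (A : ell2 -> ell2) : \bar R :=
  ereal_sup [set norm2 (A x) | x in [set x : ell2 | (norm2 x <= 1)%E]].

Definition norm11 (A : ell2 -> ell2) : \bar R :=
  (\sum_(k <oo) \sum_(l <oo) (modulus (dot (A (delta k)) (delta l)))%:E)%E.

Definition Gamma (A : ell2 -> ell2) : Prop :=
  [/\ linear A, (opnorm2 A < +oo)%E,
      forall x y : ell2, dot (A x) y = dot x (A y),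
      forall x : ell2, 0 <= dot (A x) x
    & (norm11 A < +oo)%E].

Definition rank1 (x : ell1) (v : ell2) : ell2 := dot v x *: ell1_ell2 x.

Definition strong_sum (B : nat -> ell2 -> ell2) (A : ell2 -> ell2) : Prop :=
  forall v : ell2,
    norm2 (A v - \sum_(0 <= k < n) B k v : ell2) @[n --> \oo] --> 0%E.

Definition gamma_plus (A : ell2 -> ell2) : \bar R :=
  ereal_inf [set (\sum_(k <oo) norm1 (x k) ^+ 2)%E |
    x in [set x : nat -> ell1 | strong_sum (fun k => rank1 (x k)) A]].

Definition Gamma_plus (A : ell2 -> ell2) : Prop :=
  Gamma A /\ (gamma_plus A < +oo)%E.

(* The limit, in the ell1 norm, of the partial sums of the series of the
   b(k) A(delta k). These are sequences in ell2, so the norm is that of the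
   underlying sequences; the limit exists as soon as norm11 A is finite. *)
Definition ellinf_ell1 (A : ell2 -> ell2) (b : ellinf) : ell1 :=
  xget 0 [set y : ell1 |
    norm1 ((y : nat -> K) - \sum_(0 <= k < n) b k *: (A (delta k) : nat -> K))
      @[n --> \oo] --> 0%E].

(* There is exactly one such operator when T is linear and bounded. *)
Definition adjoint (T : ell1 -> ell1) : ellinf -> ellinf :=
  xget (fun=> 0) [set S : ellinf -> ellinf |
    forall (b : ellinf) (x : ell1), dot (S b) x = dot b (T x)].

(* T A T^*, as an operator on ell2. *)
Definition conj_op (T : ell1 -> ell1) (A : ell2 -> ell2) (v : ell2) : ell2 :=
  ell1_ell2 (T (ellinf_ell1 A (adjoint T (ell2_ellinf v)))).

End operators.

(* Main.v *)
Require Import Defs.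
From mathcomp Require Import all_boot all_order all_algebra.
From mathcomp Require Import complex.
From mathcomp Require Import all_classical all_reals all_analysis.

(** Let [A] be the strong sum of the [x_j x_j^*] with [sum_j ||x_j||_1^2] finite.
    Then [A b = sum_j <b, x_j> x_j] in [ell1] for every bounded [b], so that
    [<T^* v, x_j> = <v, T x_j>] and the continuity of [T] give
    [T A T^* v = sum_j <v, T x_j> T x_j].  Thus [T A T^*] is the strong sum of the
    [(T x_j) (T x_j)^*], and [sum_j ||T x_j||_1^2 <= ||T||^2 sum_j ||x_j||_1^2].
    Membership in [Gamma] needs no property of [A]: any strong sum of [y_j y_j^*]
    with [sum_j ||y_j||_1^2] finite is in [Gamma].  Since every series pairs [ell1]
    with [ellinf], absolute summability and Fubini are the only analytic tools. *)

Set Implicit Arguments.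
Unset Strict Implicit.
Unset Printing Implicit Defensive.

Import Order.TTheory GRing.Theory Num.Theory.
Import numFieldNormedType.Exports.

Local Open Scope classical_set_scope.
Local Open Scope ring_scope.

(** * Conjugation, modulus and convergence over both scalar fields *)

Section scalars.
Context {R : realType} {s : scalars}.
Local Notation K := (scalar_field R s).
Implicit Types x y : K.

Lemma conjsD x y : conjs (x + y) = conjs x + conjs y.
Proof. by case: s x y => //= x y; exact: rmorphD. Qed.

Lemma conjsM x y : conjs (x * y) = conjs x * conjs y.
Proof. by case: s x y => //= x y; exact: rmorphM. Qed.

Lemma conjs0 : conjs (0 : K) = 0.
Proof. by apply: (addrI (conjs 0)); rewrite -conjsD !addr0. Qed.

Lemma conjsN x : conjs (- x) = - conjs x.
Proof. by apply/eqP; rewrite -subr_eq0 opprK -conjsD addNr conjs0. Qed.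

Lemma conjs1 : conjs (1 : K) = 1.
Proof. by case: s => //=; rewrite /conjc/= oppr0. Qed.

Lemma conjsK x : conjs (conjs x) = x.
Proof. by case: s x => //= x; exact: conjcK. Qed.

Lemma conjs_sum (I : Type) (r : seq I) (F : I -> K) :
  conjs (\sum_(i <- r) F i) = \sum_(i <- r) conjs (F i).
Proof. by apply: big_morph; [exact: conjsD|exact: conjs0]. Qed.

Lemma modulus_conjs x : modulus (conjs x) = modulus x.
Proof. by case: s x => [x//|[a b]]; rewrite /= sqrrN. Qed.

Lemma mul_conjs_ge0 x : 0 <= x * conjs x.
Proof.
case: s x => [x|[a b]] /=; first by rewrite -expr2 sqr_ge0.
have -> : (a +i* b)%C * (a -i* b)%C = (a ^+ 2 + b ^+ 2)%:C%C.
  by apply/eqP; rewrite eq_complex/= !mulrN opprK [b * a]mulrC addNr !expr2 !eqxx.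
by rewrite ler0c addr_ge0 ?sqr_ge0.
Qed.

Lemma modulus_eq0 x : modulus x = 0 -> x = 0.
Proof. by case: s x => [x /normr0_eq0//|x /Normc.eq0_normc]. Qed.

Lemma ler_modulus_sum (I : Type) (r : seq I) (F : I -> K) :
  modulus (\sum_(i <- r) F i) <= \sum_(i <- r) modulus (F i).
Proof.
elim/big_ind2 : _ => //; first by rewrite modulus0.
by move=> a b c d ab cd; rewrite (le_trans (ler_modulusD _ _))// lerD.
Qed.

Local Open Scope ereal_scope.

Lemma squeeze_cvge0 (f g : nat -> \bar R) :
  (forall n, 0 <= f n <= g n) -> g n @[n --> \oo] --> 0 -> f n @[n --> \oo] --> 0.
Proof.
move=> fg g0; apply: (squeeze_cvge _ (cvg_cst 0) g0).
by apply: nearW => n; exact: fg.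
Qed.

(** The norm of [R[i]] is [R[i]]-valued. This equivalence moves convergence of scalars into
    [\bar R], where the error can be squeezed by tails of nonnegative series. *)
Lemma cvg_modulusP (u : nat -> K) (l : K) :
  u n @[n --> \oo] --> l <-> (modulus (l - u n)%R)%:E @[n --> \oo] --> 0.
Proof.
have E : (modulus (l - u n)%R)%:E @[n --> \oo] --> 0 <->
         modulus (l - u n)%R @[n --> \oo] --> (0 : R)%R.
  split=> [/fine_cvg//|h].
  by apply: cvg_EFin => //; exact: nearW.
apply: (iff_trans _ (iff_sym E)) => {E}.
rewrite !cvgrPdist_lt; split=> h e e0.
- near=> n; rewrite sub0r normrN ger0_norm ?modulus_ge0//; near: n.
  case: s u l h e e0 => u l h e e0; first exact: h.
  have e0' : (0 < e%:C%C)%R by rewrite ltcR.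
  apply: filterS (h _ e0') => n.
  by case: (l - u n)%R => a b; rewrite normc_def ltcR.
- case: s u l h e e0 => u l h e e0; rewrite /=.
    by apply: filterS (h _ e0) => n /=; rewrite sub0r normrN normr_id.
  (* A positive element of [R[i]] has zero imaginary part, so the tolerance is the real number
     [a]. *)
  move: e0; case: e => a b; rewrite ltcE => /andP[/eqP/= -> a0].
  apply: filterS (h _ a0) => n /=.
  rewrite sub0r normrN ger0_norm ?sqrtr_ge0; last exact: (@modulus_ge0 R ComplexScalars).
  by case: (l - u n)%R => c d; rewrite normc_def ltcR.
Unshelve. all: by end_near. Qed.

Lemma cvg_modulus (u : nat -> K) (l : K) :
  (modulus (l - u n)%R)%:E @[n --> \oo] --> 0 -> cvgn u.
Proof. by move=> /cvg_modulusP; exact: cvgP. Qed.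

End scalars.

(** * Absolutely convergent scalar series and Fubini *)

Section scalar_series.
Context {R : realType} {s : scalars}.
Local Notation K := (scalar_field R s).
Implicit Types f g : nat -> K.
Local Open Scope ereal_scope.

(** The triangle inequality through a late term [u n] costs less than any given [e]. *)
Lemma modulus_lim_le (u : nat -> K) (l w : K) (c : \bar R) :
  u n @[n --> \oo] --> l -> (\forall n \near \oo, (modulus (u n - w)%R)%:E <= c) ->
  (modulus (l - w)%R)%:E <= c.
Proof.
move=> /cvg_modulusP/fine_cvgP[_ /cvgrPdist_lt ul] uc.
apply/lee_addgt0Pr => e e0.
near \oo => n.
have h1 : (modulus (l - u n)%R < e)%R.
  have : (`|0 - modulus (l - u n)%R| < e)%R by near: n; exact: ul.
  by rewrite sub0r normrN ger0_norm ?modulus_ge0.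
have h2 : (modulus (u n - w)%R)%:E <= c by near: n.
apply: le_trans (leeD h2 (ltW h1 : _%:E <= _%:E)).
rewrite -EFinD lee_fin [leRHS]addrC (_ : (l - w = (l - u n) + (u n - w))%R).
  exact: ler_modulusD.
by rewrite addrA subrK.
Unshelve. all: by end_near. Qed.

Lemma nneseries_tail_le (u : nat -> \bar R) n : (forall k, 0 <= u k) ->
  \sum_(n <= k <oo) u k <= \sum_(k <oo) u k.
Proof.
by move=> u0; rewrite [leRHS](nneseries_split 0 n)// add0n leeDr// sume_ge0.
Qed.

Lemma le_nneseries_term (u : nat -> \bar R) j : (forall k, 0 <= u k) ->
  u j <= \sum_(k <oo) u k.
Proof.
by move=> u0; rewrite (nneseriesD1 (n := j))// leeDl// nneseries_ge0.
Qed.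

(** The common form of all scalar series here. It has its intended meaning when [norm1 f] is finite,
    and [dot] is an instance by definition. *)
Definition tsum f : K := limn (fun n => (\sum_(0 <= k < n) f k)%R).

Lemma dotE (x y : nat -> K) : dot x y = tsum (fun k => x k * conjs (y k))%R.
Proof. by []. Qed.

Lemma norm1_ge0 f : 0 <= norm1 f.
Proof. by apply: nneseries_ge0 => k _ _; rewrite lee_fin modulus_ge0. Qed.

Lemma le_norm1 f g : (forall k, (modulus (f k) <= modulus (g k))%R) -> norm1 f <= norm1 g.
Proof.
by move=> fg; apply: lee_nneseries => k *; rewrite lee_fin ?modulus_ge0.
Qed.

Lemma norm1Z (a : K) f : norm1 (fun k => a * f k)%R = (modulus a)%:E * norm1 f.
Proof.
rewrite /norm1 -nneseriesZl; last by move=> k _; rewrite lee_fin modulus_ge0.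
by apply: eq_eseriesr => k _; rewrite modulusM EFinM.
Qed.

Lemma norm1D f g : norm1 (f \+ g)%R <= norm1 f + norm1 g.
Proof.
rewrite /norm1 -nneseriesD; last 2 first.
- by move=> k _ _; rewrite lee_fin modulus_ge0.
- by move=> k _ _; rewrite lee_fin modulus_ge0.
apply: lee_nneseries => k *; first by rewrite lee_fin modulus_ge0.
by rewrite -EFinD lee_fin ler_modulusD.
Qed.

Lemma abs_series_cvg (f : nat -> R) : (\sum_(k <oo) `|f k|%:E < +oo) ->
  cvgn (fun n => (\sum_(0 <= k < n) f k)%R).
Proof.
move=> h; apply: (@normed_cvg R R^o f).
apply: nondecreasing_is_cvgn.
  by apply: nondecreasing_series => k _ _; exact: normr_ge0.
have := ge0_fin_numE (x := \sum_(k <oo) `|f k|%:E).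
rewrite nneseries_ge0// => /(_ isT) => fin.
rewrite h in fin.
exists (fine (\sum_(k <oo) `|f k|%:E)) => _ [n _ <-].
rewrite -lee_fin fineK// /series/= -sumEFin.
by apply: nneseries_lim_ge => k _ _; rewrite lee_fin.
Qed.

(** In the complex case the real and imaginary parts are dominated by the modulus, so both converge
    absolutely; the modulus of the error is at most the sum of the errors of the two parts. *)
Lemma norm1_cvg f : norm1 f < +oo -> cvgn (fun n => (\sum_(0 <= k < n) f k)%R).
Proof.
case: s f => f hf; first exact: abs_series_cvg.
have hre : \sum_(k <oo) `|complex.Re (f k)|%:E < +oo.
  refine (le_lt_trans _ hf); apply: lee_nneseries => k * //.
  rewrite lee_fin; case: (f k) => a b /=.
  by rewrite -sqrtr_sqr ler_wsqrtr// lerDl sqr_ge0.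
have him : \sum_(k <oo) `|complex.Im (f k)|%:E < +oo.
  refine (le_lt_trans _ hf); apply: lee_nneseries => k * //.
  rewrite lee_fin; case: (f k) => a b /=.
  by rewrite -sqrtr_sqr ler_wsqrtr// lerDr sqr_ge0.
have /cvg_ex[/= a ha] := abs_series_cvg hre.
have /cvg_ex[/= b hb] := abs_series_cvg him.
apply: (@cvg_modulus R ComplexScalars _ (a +i* b)%C).
move/(@cvg_modulusP R RealScalars): ha => ha.
move/(@cvg_modulusP R RealScalars): hb => hb.
have := cvgeD (isT : 0 +? 0) ha hb; rewrite adde0 => /(_ _); apply: squeeze_cvge0 => n.
rewrite lee_fin modulus_ge0/= -EFinD lee_fin.
rewrite (_ : (\sum_(0 <= k < n) f k)%R =
  ((\sum_(0 <= k < n) complex.Re (f k))%R +i*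
   (\sum_(0 <= k < n) complex.Im (f k))%R)%C); last first.
  elim/big_rec3 : _ => // k x y z _ ->.
  by case: (f k).
rewrite /=.
move: (a - _)%R (b - _)%R => u v.
(* The bound of [sqrt (u^2 + v^2)] by [|u| + |v|], obtained by comparing squares. *)
rewrite -[leRHS]ger0_norm ?addr_ge0// -sqrtr_sqr ler_wsqrtr//.
rewrite sqrrD !real_normK ?num_real// -addrA [(_ *+ 2 + _)%R]addrC addrA lerDl.
by rewrite mulrn_wge0 ?mulr_ge0.
Qed.

Lemma tsum_cvg f : norm1 f < +oo -> (\sum_(0 <= k < n) f k)%R @[n --> \oo] --> tsum f.
Proof. exact: norm1_cvg. Qed.

Lemma tsum_eq f (l : K) : (\sum_(0 <= k < n) f k)%R @[n --> \oo] --> l -> tsum f = l.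
Proof. by apply: cvg_lim; exact: norm_hausdorff. Qed.

Lemma tsum0 : tsum (fun=> 0%R) = 0%R.
Proof. by apply: tsum_eq; under eq_fun do rewrite big1//; exact: cvg_cst. Qed.

Lemma tsumD f g : norm1 f < +oo -> norm1 g < +oo ->
  tsum (fun k => f k + g k)%R = (tsum f + tsum g)%R.
Proof.
move=> hf hg; apply: tsum_eq; under eq_fun do rewrite big_split/=.
by apply: cvgD; exact: tsum_cvg.
Qed.

Lemma tsumZ (a : K) f : norm1 f < +oo -> tsum (fun k => a * f k)%R = (a * tsum f)%R.
Proof.
move=> hf; apply: tsum_eq; under eq_fun do rewrite -mulr_sumr.
by apply: cvgMl_tmp; exact: tsum_cvg.
Qed.

Lemma tsum_conjs f : norm1 f < +oo -> tsum (fun k => conjs (f k)) = conjs (tsum f).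
Proof.
move=> hf; apply: tsum_eq; apply/cvg_modulusP.
under eq_fun do rewrite -conjs_sum -conjsN -conjsD modulus_conjs.
by apply/cvg_modulusP; exact: tsum_cvg.
Qed.

(** Nonnegative partial sums equal their own norms, so by uniqueness of limits [tsum f] equals its
    norm. The argument also serves the partial order of [R[i]]. *)
Lemma tsum_ge0 f : norm1 f < +oo -> (forall k, 0 <= f k)%R -> (0 <= tsum f)%R.
Proof.
move=> hf f0; have h := tsum_cvg hf.
have := cvg_norm h.
under eq_fun do rewrite ger0_norm ?sumr_ge0//.
by move=> /(_ _)/(cvg_unique _ h) ->.
Qed.

(** A later partial sum differs from the [n]-th by a finite stretch of the tail, and the bound
    passes to the limit. The remainder estimates for vector series rest on this one. *)
Lemma modulus_tsum_sub f n : norm1 f < +oo ->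
  (modulus (tsum f - \sum_(0 <= k < n) f k)%R)%:E <= \sum_(n <= k <oo) (modulus (f k))%:E.
Proof.
move=> hf; apply: modulus_lim_le (tsum_cvg hf) _.
near=> N.
have nN : (n <= N)%N by near: N; exact: nbhs_infty_ge.
rewrite (big_cat_nat (leq0n n) nN)/= addrAC subrr add0r.
rewrite (le_trans _ (nneseries_lim_ge N _))//; last by move=> *; rewrite lee_fin modulus_ge0.
by rewrite sumEFin lee_fin ler_modulus_sum.
Unshelve. all: by end_near. Qed.

Lemma modulus_tsum f : norm1 f < +oo -> (modulus (tsum f))%:E <= norm1 f.
Proof. by move=> /modulus_tsum_sub-/(_ 0%N); rewrite big_nil subr0. Qed.

(** Absolute convergence in [ell1] implies norm convergence to the coordinatewise sum: each
    coordinate of the remainder is bounded by a scalar tail, and Tonelli turns the sum of these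
    tails into a tail of norms. *)
Lemma norm1_tsum (F : nat -> nat -> K) : \sum_(j <oo) norm1 (F j) < +oo ->
  (forall k, norm1 (F ^~ k) < +oo) /\
  forall n, norm1 (fun k => tsum (F ^~ k) - \sum_(0 <= j < n) F j k)%R
     <= \sum_(n <= j <oo) norm1 (F j).
Proof.
move=> hF.
have h k : norm1 (F ^~ k) < +oo.
  apply: le_lt_trans hF; apply: lee_nneseries => j *; last exact: le_modulus_norm1.
  by rewrite lee_fin modulus_ge0.
split=> // n.
(* The lower bound [n] becomes a condition on the index, so that the exchange concerns two series
   starting at 0. *)
rewrite eseries_cond nneseries_interchange; last by move=> *; rewrite lee_fin modulus_ge0.
apply: lee_nneseries => k *; first by rewrite lee_fin modulus_ge0.
by rewrite -eseries_cond; exact: modulus_tsum_sub.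
Qed.

Lemma norm1_tail_cvg (F : nat -> nat -> K) : \sum_(j <oo) norm1 (F j) < +oo ->
  \sum_(n <= j <oo) norm1 (F j) @[n --> \oo] --> 0.
Proof. by move=> hF; apply: nneseries_tail_cvg => // k _; exact: norm1_ge0. Qed.

Lemma norm1_tsum_le (F : nat -> nat -> K) : \sum_(j <oo) norm1 (F j) < +oo ->
  norm1 (fun k => tsum (F ^~ k)) <= \sum_(j <oo) norm1 (F j).
Proof.
move=> /norm1_tsum[_ /(_ 0%N)]; apply: le_trans.
by apply: le_norm1 => k; rewrite big_nil subr0.
Qed.

Lemma norm1_sum_lty (I : Type) (r : seq I) (F : I -> nat -> K) :
  (forall i, norm1 (F i) < +oo) -> norm1 (fun k => \sum_(i <- r) F i k)%R < +oo.
Proof.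
move=> hF; elim: r => [|i r ih].
  apply: le_lt_trans (_ : 0 < _) => //; rewrite /norm1 eseries0// => k _ _.
  by rewrite big_nil modulus0.
apply: (@le_lt_trans _ _ (norm1 (F i) + norm1 (fun k => \sum_(i <- r) F i k)%R)).
  by apply: le_trans (norm1D _ _); apply: le_norm1 => k /=; rewrite big_cons.
exact: lte_add_pinfty.
Qed.

Lemma tsum_sum (I : Type) (r : seq I) (F : I -> nat -> K) :
  (forall i, norm1 (F i) < +oo) ->
  tsum (fun k => \sum_(i <- r) F i k)%R = (\sum_(i <- r) tsum (F i))%R.
Proof.
move=> hF; elim: r => [|i r ih].
  by rewrite big_nil -[RHS]tsum0; congr tsum; apply/funext => k; rewrite big_nil.
rewrite big_cons -ih -tsumD//; last exact: norm1_sum_lty.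
by congr tsum; apply/funext => k; rewrite big_cons.
Qed.

(** Fubini: the error after [n] terms of the outer series over [j] is the sum over [k] of the
    coordinate remainders, hence at most the tail of [norm1 (F j)]. *)
Lemma tsum_exchange (F : nat -> nat -> K) : \sum_(j <oo) norm1 (F j) < +oo ->
  tsum (fun k => tsum (fun j => F j k)) = tsum (fun j => tsum (F j)).
Proof.
move=> hF; apply/esym/tsum_eq/cvg_modulusP.
have F1 j : norm1 (F j) < +oo.
  apply: le_lt_trans hF; apply: (le_nneseries_term (u := norm1 \o F)) => i.
  exact: norm1_ge0.
have [Fk Fn] := norm1_tsum hF.
have FS := le_lt_trans (norm1_tsum_le hF) hF.
apply: squeeze_cvge0 (norm1_tail_cvg hF) => n; rewrite lee_fin modulus_ge0/=.
apply: le_trans (Fn n).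
(* The subtraction is written as a scaling by -1, so that additivity and homogeneity merge the error
   into a single [tsum]. *)
rewrite -tsum_sum// -[X in (_ + X)%R]mulN1r -tsumZ; last exact: norm1_sum_lty.
rewrite -tsumD//; last first.
  by rewrite norm1Z lte_mul_pinfty ?lee_fin ?modulus_ge0// norm1_sum_lty.
under [fun k => (_ + _)%R]eq_fun do rewrite mulN1r.
apply: modulus_tsum.
apply: le_lt_trans (Fn n) _; apply: le_lt_trans hF.
by apply: nneseries_tail_le => j; exact: norm1_ge0.
Qed.

End scalar_series.

(** * The pairing of bounded with summable sequences, and comparison of norms *)

Section pairing.
Context {R : realType} {s : scalars}.
Local Notation K := (scalar_field R s).
Implicit Types f g b x y : nat -> K.
Local Open Scope ereal_scope.

Lemma norminf_ge0 x : 0 <= norminf x.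
Proof. by apply: le_trans (le_modulus_norminf x 0%N); rewrite lee_fin modulus_ge0. Qed.

Lemma norminf_fin_num x : norminf x < +oo -> norminf x \is a fin_num.
Proof. by rewrite ge0_fin_numE ?norminf_ge0. Qed.

Lemma norm1_conjs f : norm1 (fun k => conjs (f k)) = norm1 f.
Proof. by apply: eq_eseriesr => k _; rewrite modulus_conjs. Qed.

Lemma norm1_mul b f : norminf b < +oo -> norm1 (fun k => b k * f k)%R <= norminf b * norm1 f.
Proof.
move=> /norminf_fin_num/fineK bE; rewrite -bE -nneseriesZl; last first.
  by move=> k _; rewrite lee_fin modulus_ge0.
apply: lee_nneseries => k *; first by rewrite lee_fin modulus_ge0.
by rewrite modulusM EFinM bE lee_wpmul2r ?le_modulus_norminf// lee_fin modulus_ge0.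
Qed.

Lemma norminfZ_nneseries b (u : nat -> \bar R) : norminf b < +oo -> (forall k, 0 <= u k) ->
  \sum_(k <oo) norminf b * u k = norminf b * \sum_(k <oo) u k.
Proof.
by move=> /norminf_fin_num/fineK <- u0; rewrite nneseriesZl.
Qed.

Lemma norminf_mul_lty b (a : \bar R) : norminf b < +oo -> a < +oo -> norminf b * a < +oo.
Proof.
move=> /norminf_fin_num/fineK <- a_lty.
by rewrite lte_mul_pinfty// lee_fin fine_ge0// norminf_ge0.
Qed.

Lemma norm1_mul_lty b f : norminf b < +oo -> norm1 f < +oo ->
  norm1 (fun k => b k * f k)%R < +oo.
Proof.
move=> hb hf; apply: le_lt_trans (norm1_mul _ hb) _.
exact: norminf_mul_lty.
Qed.

Lemma dot_summable b x : norminf b < +oo -> norm1 x < +oo ->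
  norm1 (fun k => b k * conjs (x k))%R < +oo.
Proof. by move=> hb hx; rewrite norm1_mul_lty// norm1_conjs. Qed.

Lemma dot_summableC b x : norminf b < +oo -> norm1 x < +oo ->
  norm1 (fun k => x k * conjs (b k))%R < +oo.
Proof.
move=> hb hx; rewrite -norm1_conjs (_ : norm1 _ = norm1 (fun k => b k * conjs (x k))%R).
  exact: dot_summable.
by congr norm1; apply/funext => k; rewrite conjsM conjsK mulrC.
Qed.

Lemma modulus_dot b x : norminf b < +oo -> norm1 x < +oo ->
  (modulus (dot b x))%:E <= norminf b * norm1 x.
Proof.
move=> hb hx; rewrite dotE -norm1_conjs.
apply: le_trans (norm1_mul (fun k => conjs (x k)) hb).
by apply: modulus_tsum; exact: dot_summable.
Qed.

Lemma dotC b x : norminf b < +oo -> norm1 x < +oo -> dot x b = conjs (dot b x).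
Proof.
move=> hb hx; rewrite !dotE -tsum_conjs; last exact: dot_summable.
by congr tsum; apply/funext => k; rewrite conjsM conjsK mulrC.
Qed.

(** Fubini for the array [b k * conjs (z j k)], whose row [j] has [norm1] at most
    [norminf b * norm1 (z j)]. *)
Lemma dot_tsumr b (z : nat -> nat -> K) : norminf b < +oo ->
  \sum_(j <oo) norm1 (z j) < +oo ->
  dot b (fun k => tsum (z ^~ k)) = tsum (fun j => dot b (z j)).
Proof.
move=> hb hz.
have [zk _] := norm1_tsum hz.
rewrite dotE -tsum_exchange; last first.
  apply: (@le_lt_trans _ _ (\sum_(j <oo) norminf b * norm1 (z j))).
    apply: lee_nneseries => j *; first exact: norm1_ge0.
    by rewrite -[norm1 (z j)]norm1_conjs; exact: norm1_mul.
  rewrite norminfZ_nneseries ?norminf_mul_lty// => j.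
  exact: norm1_ge0.
congr tsum; apply/funext => k.
rewrite -tsum_conjs// tsumZ// (_ : norm1 _ = norm1 (z ^~ k)) ?zk//.
exact: norm1_conjs.
Qed.

Lemma dot_tsuml b (z : nat -> nat -> K) : norminf b < +oo ->
  \sum_(j <oo) norm1 (z j) < +oo ->
  dot (fun k => tsum (z ^~ k)) b = tsum (fun j => dot (z j) b).
Proof.
move=> hb hz.
have z1 j : norm1 (z j) < +oo.
  apply: le_lt_trans hz; apply: (le_nneseries_term (u := norm1 \o z)) => i.
  exact: norm1_ge0.
rewrite dotC//; last exact: le_lt_trans (norm1_tsum_le hz) hz.
rewrite dot_tsumr// -tsum_conjs.
  by congr tsum; apply/funext => j; rewrite -dotC.
apply: (@le_lt_trans _ _ (\sum_(j <oo) norminf b * norm1 (z j))).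
  apply: lee_nneseries => j *; first by rewrite lee_fin modulus_ge0.
  exact: modulus_dot.
rewrite norminfZ_nneseries ?norminf_mul_lty// => j.
exact: norm1_ge0.
Qed.

Lemma dotZl (a : K) x y : norm1 (fun k => x k * conjs (y k))%R < +oo ->
  dot (fun k => a * x k)%R y = (a * dot x y)%R.
Proof.
move=> hxy; rewrite !dotE -tsumZ//.
by congr tsum; apply/funext => k; rewrite mulrA.
Qed.

Lemma dotZr (a : K) b x : norminf b < +oo -> norm1 x < +oo ->
  dot b (fun k => a * x k)%R = (conjs a * dot b x)%R.
Proof.
move=> hb hx; rewrite !dotE -tsumZ; last exact: dot_summable.
by congr tsum; apply/funext => k; rewrite conjsM mulrCA.
Qed.

Lemma dotDl b c x : norminf b < +oo -> norminf c < +oo -> norm1 x < +oo ->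
  dot (fun k => b k + c k)%R x = (dot b x + dot c x)%R.
Proof.
move=> hb hc hx; rewrite !dotE -tsumD; try exact: dot_summable.
by congr tsum; apply/funext => k; rewrite mulrDl.
Qed.

(** Termwise, the square of [modulus (x k)] is at most [norm1 x * modulus (x k)]. This turns [ell1]
    remainders into strong convergence on [ell2]. *)
Lemma norm2_le_norm1 x : norm2 x <= norm1 x.
Proof.
have [hx|] := ltP (norm1 x) +oo; last by rewrite leye_eq => /eqP ->; rewrite leey.
have x1fin : norm1 x \is a fin_num by rewrite ge0_fin_numE ?norm1_ge0.
rewrite -[leRHS]gee0_abs ?norm1_ge0// -sqrte_sqr lee_sqrt ?sqre_ge0//.
rewrite expe2 -{1}(fineK x1fin) -nneseriesZl; last by move=> k _; rewrite lee_fin modulus_ge0.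
apply: lee_nneseries => k *; first by rewrite lee_fin sqr_ge0.
by rewrite fineK// expr2 EFinM lee_wpmul2r ?le_modulus_norm1// lee_fin modulus_ge0.
Qed.

Lemma le_modulus_norm2 x k : (modulus (x k))%:E <= norm2 x.
Proof.
rewrite -[leLHS]gee0_abs ?lee_fin ?modulus_ge0// -sqrte_sqr lee_sqrt; last first.
  by rewrite nneseries_ge0// => j _ _; rewrite lee_fin sqr_ge0.
rewrite [leRHS](nneseriesD1 (n := k))//; last by move=> j _; rewrite lee_fin sqr_ge0.
by rewrite -EFin_expe leeDl// nneseries_ge0// => j _ _; rewrite lee_fin sqr_ge0.
Qed.

Lemma norminf_le_norm2 x : norminf x <= norm2 x.
Proof. by apply: ge_ereal_sup => _ [k _ <-]; exact: le_modulus_norm2. Qed.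

(** Supplies the scalar of [K] by which a vector of norm [r] is normalised. *)
Lemma exists_modulus (r : R) : (0 <= r)%R -> exists a : K, modulus a = r.
Proof.
case: s => r0; first by exists r; exact: ger0_norm.
by exists (r%:C)%C; rewrite /= expr0n addr0 sqrtr_sqr ger0_norm.
Qed.

End pairing.

(** * Elements of the sequence spaces and the operator norm on [ell1] *)

Section ell_ops.
Context {R : realType} {s : scalars}.
Local Notation K := (scalar_field R s).
Local Open Scope ereal_scope.

Lemma ell1_lty (x : ell1 R s) : norm1 x < +oo. Proof. exact: (ell1P x). Qed.
Lemma ell2_lty (x : ell2 R s) : norm2 x < +oo. Proof. exact: (ell2P x). Qed.
Lemma ell2_norminf_lty (x : ell2 R s) : norminf x < +oo.
Proof. exact: norm2_norminf_lty (ell2_lty x). Qed.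
Lemma ellinf_lty (x : ellinf R s) : norminf x < +oo. Proof. exact: (ellinfP x). Qed.
Lemma ell1_norminf_lty (x : ell1 R s) : norminf x < +oo.
Proof. exact: norm2_norminf_lty (norm1_norm2_lty (ell1P x)). Qed.

Lemma ell1_sumE (I : Type) (r : seq I) (F : I -> ell1 R s) k :
  ((\sum_(i <- r) F i)%R : ell1 R s) k = (\sum_(i <- r) F i k)%R.
Proof. by elim/big_ind2 : _ => // x a y b <- <-. Qed.

Lemma ell2_sumE (I : Type) (r : seq I) (F : I -> ell2 R s) k :
  ((\sum_(i <- r) F i)%R : ell2 R s) k = (\sum_(i <- r) F i k)%R.
Proof. by elim/big_ind2 : _ => // x a y b <- <-. Qed.

Lemma ell1_eq (x y : ell1 R s) : (forall k, x k = y k) -> x = y.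
Proof. by move=> xy; apply: val_inj; apply/funext. Qed.

Lemma ell2_eq (x y : ell2 R s) : (forall k, x k = y k) -> x = y.
Proof. by move=> xy; apply: val_inj; apply/funext. Qed.

Lemma opnorm1_ge0 (T : ell1 R s -> ell1 R s) : 0 <= opnorm1 T.
Proof.
apply: le_trans (norm1_ge0 (T 0%R)) _; apply: ereal_sup_ubound; exists 0%R => //=.
by rewrite /norm1 eseries0 ?lee_fin// => k _ _; rewrite modulus0.
Qed.

(** Homogeneity reduces to the unit ball: [x] is divided by a scalar [a] of modulus [norm1 x]. A
    vector of norm zero cannot be normalised and is treated apart. *)
Lemma le_opnorm1 (T : {linear ell1 R s -> ell1 R s}) (x : ell1 R s) :
  opnorm1 T < +oo -> norm1 (T x) <= opnorm1 T * norm1 x.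
Proof.
move=> hT.
have xfin : norm1 x \is a fin_num by rewrite ge0_fin_numE ?norm1_ge0 ?ell1_lty.
have [r rE] : exists r : R, norm1 x = r%:E by exists (fine (norm1 x)); rewrite fineK.
have r0 : (0 <= r)%R by rewrite -lee_fin -rE norm1_ge0.
have [r00|rn0] := eqVneq r 0%R.
  have -> : x = 0%R.
    apply: ell1_eq => k; apply: modulus_eq0; apply/eqP.
    by rewrite eq_le modulus_ge0 andbT -lee_fin -r00 -rE le_modulus_norm1.
  rewrite linear0 (_ : norm1 _ = 0) ?mule_ge0 ?opnorm1_ge0 ?norm1_ge0//.
  by rewrite /norm1 eseries0// => k _ _; rewrite modulus0.
have [a aE] := @exists_modulus R s r r0.
have a0 : a != 0%R by apply: contra_neq rn0 => a0; rewrite -aE a0 modulus0.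
have {1}-> : x = (a *: (a^-1 *: x))%R by rewrite scalerA divff// scale1r.
rewrite linearZ/= (_ : norm1 _ = norm1 (fun k => a * T (a^-1 *: x)%R k)%R)//.
rewrite norm1Z aE rE muleC lee_wpmul2r ?lee_fin//.
apply: ereal_sup_ubound; exists (a^-1 *: x)%R => //=.
rewrite (_ : norm1 _ = norm1 (fun k => a^-1 * x k)%R)// norm1Z rE -EFinM lee_fin.
by rewrite -aE -modulusM mulVf// modulus1.
Qed.

End ell_ops.

(** * The standard basis *)

Section deltas.
Context {R : realType} {s : scalars}.
Local Notation K := (scalar_field R s).
Local Open Scope ereal_scope.

Lemma tsum_single (f : nat -> K) l : (forall k, k != l -> f k = 0%R) -> tsum f = f l.
Proof.
move=> f0; apply: tsum_eq; apply: cvg_near_cst.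
near=> n.
have ln : (l < n)%N by near: n; exact: nbhs_infty_gt.
rewrite big_mkord (bigD1 (Ordinal ln))//= big1 ?addr0// => k kl.
by apply: f0; move: kl; apply: contra => /eqP kl; apply/eqP/val_inj.
Unshelve. all: by end_near. Qed.

Lemma dot_delta (w : nat -> K) l : dot w (delta l) = w l.
Proof.
rewrite dotE (@tsum_single _ l)/= ?eqxx ?conjs1 ?mulr1// => k kl.
by rewrite (negPf kl) conjs0 mulr0.
Qed.

Lemma dot_deltal (x : ell1 R s) l : dot (delta l) x = conjs (x l).
Proof.
rewrite (@dotC _ _ x (delta l)) ?dot_delta ?ell1_norminf_lty//.
exact: ell1_lty (delta1 l).
Qed.

Lemma norm1_delta l : norm1 (delta1 l : ell1 R s) = 1.
Proof.
rewrite /norm1 (nneseriesD1 (n := l))//; last by move=> j _; rewrite lee_fin modulus_ge0.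
rewrite eseries_mkcond eseries0 ?adde0/= ?eqxx ?modulus1// => j _ _.
by case: ifPn => //= /negPf ->; rewrite modulus0.
Qed.

(** The basis expansion, in the coordinatewise form that [linear_tsum] takes as hypothesis. *)
Lemma ell1_delta_tsum (x : ell1 R s) l : x l = tsum (fun k => (x k *: delta1 k : ell1 R s)%R l).
Proof.
rewrite (@tsum_single _ l) /= => [|k kl].
  by rewrite [RHS](_ : _ = x l * (l == l)%:R)%R// eqxx mulr1.
by rewrite [LHS](_ : _ = x k * (l == k)%:R)%R// eq_sym (negPf kl) mulr0.
Qed.

End deltas.

(** * Continuity of [T], its adjoint, and the action of [A] on bounded sequences *)

Section bounded_operators.
Context {R : realType} {s : scalars}.
Local Notation K := (scalar_field R s).
Local Open Scope ereal_scope.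

Lemma opnorm1_mul_lty (T : ell1 R s -> ell1 R s) (a : \bar R) :
  opnorm1 T < +oo -> a < +oo -> opnorm1 T * a < +oo.
Proof.
move=> hT a_lty; have Tfin : opnorm1 T \is a fin_num by rewrite ge0_fin_numE ?opnorm1_ge0.
by rewrite -(fineK Tfin) lte_mul_pinfty// lee_fin fine_ge0// opnorm1_ge0.
Qed.

Lemma opnorm1_nneseries (T : {linear ell1 R s -> ell1 R s}) (z : nat -> ell1 R s) n :
  opnorm1 T < +oo ->
  \sum_(n <= j <oo) norm1 (T (z j)) <= opnorm1 T * \sum_(n <= j <oo) norm1 (z j).
Proof.
move=> hT; have Tfin : opnorm1 T \is a fin_num by rewrite ge0_fin_numE ?opnorm1_ge0.
rewrite -(fineK Tfin) -nneseriesZl; last by move=> *; exact: norm1_ge0.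
by apply: lee_nneseries => *; rewrite ?norm1_ge0// fineK// le_opnorm1.
Qed.

(** The partial sums of [z] converge to [S] in [norm1], and the bound on [T] carries their
    remainders over; a coordinate is dominated by the norm. *)
Lemma linear_tsum (T : {linear ell1 R s -> ell1 R s}) (z : nat -> ell1 R s) (S : ell1 R s) :
  opnorm1 T < +oo -> \sum_(j <oo) norm1 (z j) < +oo ->
  (forall l, S l = tsum (fun j => z j l)) ->
  forall l, T S l = tsum (fun j => T (z j) l).
Proof.
move=> hT hz hS l; apply/esym/tsum_eq/cvg_modulusP.
have Tfin : opnorm1 T \is a fin_num by rewrite ge0_fin_numE ?opnorm1_ge0.
have := cvgeZl Tfin (norm1_tail_cvg hz); rewrite mule0.
apply: squeeze_cvge0 => n; rewrite lee_fin modulus_ge0/=.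
have [_ /(_ n) hn] := norm1_tsum hz.
have h : norm1 (S - \sum_(0 <= j < n) z j : ell1 R s)%R <= \sum_(n <= j <oo) norm1 (z j).
  apply: le_trans hn; apply: le_norm1 => k.
  by rewrite -hS -ell1_sumE.
apply: (@le_trans _ _ (norm1 (T (S - \sum_(0 <= j < n) z j)%R))); last first.
  by apply: le_trans (le_opnorm1 _ hT) _; rewrite lee_wpmul2l ?opnorm1_ge0.
rewrite linearB (linear_sum T)/= -ell1_sumE.
exact: (le_modulus_norm1 (T S - \sum_(0 <= j < n) T (z j) : ell1 R s)%R l).
Qed.

Lemma adjointP (T : {linear ell1 R s -> ell1 R s}) : opnorm1 T < +oo ->
  forall (b : ellinf R s) (x : ell1 R s), dot (adjoint T b) x = dot b (T x).
Proof.
move=> hT; apply: (@xgetPex _ (fun=> 0%R)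
  [set S : ellinf R s -> ellinf R s |
    forall (b : ellinf R s) (x : ell1 R s), dot (S b) x = dot b (T x)]).
(* Testing the adjoint relation on [delta1 k] dictates coordinate [k] of the witness; it is bounded
   by [norminf b * opnorm1 T]. *)
have hS (b : ellinf R s) : norminf (fun k => dot b (T (delta1 k))) < +oo.
  apply: le_lt_trans (norminf_mul_lty (ellinf_lty b) hT).
  apply: ge_ereal_sup => _ [k _ <-].
  apply: le_trans (modulus_dot (ellinf_lty b) (ell1_lty _)) _.
  rewrite lee_wpmul2l ?norminf_ge0//.
  by apply: le_trans (le_opnorm1 _ hT) _; rewrite norm1_delta mule1.
exists (fun b => Ellinf (hS b)) => b x.
pose z k := (x k *: delta1 k : ell1 R s)%R.
have zE k : norm1 (z k) = (modulus (x k))%:E.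
  by rewrite (norm1Z (x k) (delta1 k)) norm1_delta mule1.
have hz : \sum_(k <oo) norm1 (z k) < +oo.
  by under eq_eseriesr do rewrite zE; exact: ell1_lty.
(* The relation extends from the basis to [x] by expanding [x] and passing the sum through [T], then
   through the pairing with [b]. *)
have -> : (T x : nat -> K) = (fun l => tsum (fun k => T (z k) l)).
  by apply/funext => l; apply: linear_tsum => // {}l; exact: ell1_delta_tsum.
rewrite (@dot_tsumr _ _ b (fun k => T (z k)))//; last 2 first.
- exact: ellinf_lty.
- by apply: le_lt_trans (opnorm1_nneseries _ _ hT) _; exact: opnorm1_mul_lty.
rewrite dotE; congr tsum; apply/funext => k /=.
rewrite mulrC -dotZr ?ellinf_lty ?ell1_lty//.
by rewrite /z linearZ.
Qed.

(** The series of [b k *: A (delta k)] converges absolutely in [ell1], so its coordinatewise sum is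
    a norm limit. Norm limits are unique, hence [xget] selects this one. *)
Lemma ellinf_ell1E (A : ell2 R s -> ell2 R s) (b : ellinf R s) : norm11 A < +oo ->
  forall l, ellinf_ell1 A b l = tsum (fun k => b k * A (delta k) l)%R.
Proof.
move=> hA.
pose z k l : K := (b k * A (delta k) l)%R.
have hz : \sum_(k <oo) norm1 (z k) < +oo.
  apply: le_lt_trans (norminf_mul_lty (ellinf_lty b) hA).
  rewrite /norm11 -norminfZ_nneseries ?ellinf_lty//; last first.
    by move=> k; apply: nneseries_ge0 => *; rewrite lee_fin modulus_ge0.
  apply: lee_nneseries => k *; first exact: norm1_ge0.
  (* By [dot_delta], the inner sum of [norm11 A] at [k] is [norm1 (A (delta k))]. *)
  rewrite norm1Z [X in _ <= _ * X](_ : _ = norm1 (A (delta k))).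
    by rewrite lee_wpmul2r ?norm1_ge0// le_modulus_norminf.
  by apply: eq_eseriesr => l _; rewrite dot_delta.
have [_ tail] := norm1_tsum hz.
have hS := le_lt_trans (norm1_tsum_le hz) hz.
rewrite /ellinf_ell1 (@xget_subset1 _ 0%R _ (Ell1 hS))//=.
  apply: squeeze_cvge0 (norm1_tail_cvg hz) => n; rewrite norm1_ge0/=.
  apply: le_trans (tail n); apply: le_norm1 => k.
  by rewrite /= !fctE fct_sumE.
move=> x y /= hx hy; apply: ell1_eq => k.
have cvgk (w : ell1 R s) :
    norm1 ((w : nat -> K) - \sum_(0 <= k < n) b k *: (A (delta k) : nat -> K))%R
      @[n --> \oo] --> 0 ->
    (\sum_(0 <= j < n) z j k)%R @[n --> \oo] --> w k.
  move=> hw; apply/cvg_modulusP; apply: squeeze_cvge0 hw => n.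
  rewrite lee_fin modulus_ge0/=; apply: le_trans (le_modulus_norm1 _ k).
  by rewrite !fctE fct_sumE.
exact: (cvg_unique _ (cvgk _ hx) (cvgk _ hy)).
Qed.

End bounded_operators.

(** * Strong sums of rank-one operators with summable squared norms *)

Section rank_one_series.
Context {R : realType} {s : scalars}.
Local Notation K := (scalar_field R s).
Local Open Scope ereal_scope.
Context (y : nat -> ell1 R s).
Context (hy : \sum_(j <oo) norm1 (y j) ^+ 2 < +oo).
Implicit Types b : nat -> K.

Let term b j k : K := (dot b (y j) * y j k)%R.

Lemma norm1_rank1_sum b : norminf b < +oo ->
  \sum_(j <oo) norm1 (term b j) <= norminf b * \sum_(j <oo) norm1 (y j) ^+ 2.
Proof.
move=> hb; rewrite -norminfZ_nneseries//; last by move=> k; rewrite expe2 mule_ge0 ?norm1_ge0.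
apply: lee_nneseries => j *; first exact: norm1_ge0.
by rewrite norm1Z expe2 muleA lee_wpmul2r ?norm1_ge0// modulus_dot ?ell1_lty.
Qed.

Lemma norm1_rank1_lty b : norminf b < +oo -> \sum_(j <oo) norm1 (term b j) < +oo.
Proof.
by move=> hb; apply: le_lt_trans (norm1_rank1_sum hb) _; exact: norminf_mul_lty.
Qed.

(** Strong convergence reduces to coordinates: [norm2] dominates each coordinate, and conversely the
    series converges absolutely in [ell1], whose tails dominate [norm2]. *)
Lemma strong_sum_rank1P (B : ell2 R s -> ell2 R s) :
  strong_sum (fun j => rank1 (y j)) B <->
  forall v l, B v l = tsum (fun j => dot v (y j) * y j l)%R.
Proof.
have partialE v l n : (B v l - \sum_(0 <= j < n) dot v (y j) * y j l =
    (B v - \sum_(0 <= j < n) rank1 (y j) v : ell2 R s) l)%R.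
  by rewrite [RHS](_ : _ = B v l - (\sum_(0 <= j < n) rank1 (y j) v : ell2 R s) l)%R// ell2_sumE.
split=> [h v l|h v].
  apply/esym/tsum_eq/cvg_modulusP; apply: squeeze_cvge0 (h v) => n.
  by rewrite lee_fin modulus_ge0/= partialE le_modulus_norm2.
have hv := norm1_rank1_lty (ell2_norminf_lty v).
apply: squeeze_cvge0 (norm1_tail_cvg hv) => n.
rewrite sqrte_ge0/=; apply: le_trans (norm2_le_norm1 _) _.
have [_ /(_ n)] := norm1_tsum hv; apply: le_trans.
apply: le_norm1 => l.
by rewrite -h partialE.
Qed.

Context (B : ell2 R s -> ell2 R s).
Context (BE : forall v l, B v l = tsum (fun j => dot v (y j) * y j l)%R).

Let BEfun v : (B v : nat -> K) = (fun l => tsum (term v ^~ l)).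
Proof. by apply/funext => l; exact: BE. Qed.

Lemma rank1_series_norm1 v : norm1 (B v) <= norminf v * \sum_(j <oo) norm1 (y j) ^+ 2.
Proof.
have hv := norm1_rank1_lty (ell2_norminf_lty v).
rewrite BEfun; apply: le_trans (norm1_tsum_le hv) _.
exact: norm1_rank1_sum (ell2_norminf_lty v).
Qed.

(** The sesquilinear form of [B], diagonalised by the functionals [dot _ (y j)]. Self-adjointness
    and positivity are read off from it. *)
Lemma rank1_series_dot (v w : ell2 R s) :
  dot (B v) w = tsum (fun j => dot v (y j) * conjs (dot w (y j)))%R.
Proof.
rewrite BEfun dot_tsuml ?ell2_norminf_lty//; last exact: norm1_rank1_lty (ell2_norminf_lty v).
congr tsum; apply/funext => j.
rewrite dotZl ?dot_summableC ?ell2_norminf_lty ?ell1_lty//.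
by rewrite (@dotC _ _ w (y j)) ?ell2_norminf_lty ?ell1_lty.
Qed.

Lemma rank1_series_dot_summable (v w : ell2 R s) :
  norm1 (fun j => dot v (y j) * conjs (dot w (y j)))%R < +oo.
Proof.
have hv := norm1_rank1_lty (ell2_norminf_lty v).
apply: le_lt_trans (norminf_mul_lty (ell2_norminf_lty w) hv).
rewrite -norminfZ_nneseries ?ell2_norminf_lty//; last by move=> *; exact: norm1_ge0.
apply: lee_nneseries => j *; first by rewrite lee_fin modulus_ge0.
rewrite norm1Z modulusM modulus_conjs EFinM muleCA lee_wpmul2l ?lee_fin ?modulus_ge0//.
by rewrite modulus_dot ?ell2_norminf_lty ?ell1_lty.
Qed.

Lemma rank1_series_delta k l : B (delta k) l = tsum (fun j => conjs (y j k) * y j l)%R.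
Proof.
by rewrite BE; congr tsum; apply/funext => j; rewrite dot_deltal.
Qed.

(** The matrix of [y_j y_j^*] has entries of modulus [|y_j(k)| |y_j(l)|], whose double sum is the
    square of [norm1 (y j)]. The sum over [l] is taken first, column by column. *)
Lemma rank1_series_norm11 : norm11 B <= \sum_(j <oo) norm1 (y j) ^+ 2.
Proof.
apply: (@le_trans _ _ (\sum_(k <oo) \sum_(j <oo) (modulus (y j k))%:E * norm1 (y j))).
  apply: lee_nneseries => k *.
    by apply: nneseries_ge0 => *; rewrite lee_fin modulus_ge0.
  rewrite [leLHS](_ : _ = norm1 (B (delta k))); last first.
    by apply: eq_eseriesr => l _; rewrite dot_delta.
  pose F j l : K := (conjs (y j k) * y j l)%R.
  have FE : \sum_(j <oo) norm1 (F j) = \sum_(j <oo) (modulus (y j k))%:E * norm1 (y j).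
    by apply: eq_eseriesr => j _; rewrite norm1Z modulus_conjs.
  have hF : \sum_(j <oo) norm1 (F j) < +oo.
    rewrite FE; apply: le_lt_trans hy; apply: lee_nneseries => j *.
      by rewrite mule_ge0 ?lee_fin ?modulus_ge0 ?norm1_ge0.
    by rewrite expe2 lee_wpmul2r ?norm1_ge0 ?le_modulus_norm1.
  rewrite -FE (_ : (B (delta k) : nat -> K) = fun l => tsum (F ^~ l)).
    exact: norm1_tsum_le.
  by apply/funext => l; exact: rank1_series_delta.
(* Tonelli brings the sum over [k] inside, where it yields the second factor [norm1 (y j)]. *)
rewrite nneseries_interchange; last first.
  by move=> *; rewrite mule_ge0 ?lee_fin ?modulus_ge0 ?norm1_ge0.
apply: lee_nneseries => j *.
  by apply: nneseries_ge0 => *; rewrite mule_ge0 ?lee_fin ?modulus_ge0 ?norm1_ge0.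
have yfin : norm1 (y j) \is a fin_num by rewrite ge0_fin_numE ?norm1_ge0 ?ell1_lty.
under eq_eseriesr do rewrite muleC -(fineK yfin).
rewrite nneseriesZl; last by move=> *; rewrite lee_fin modulus_ge0.
by rewrite fineK// expe2.
Qed.

Lemma rank1_series_Gamma : Gamma B.
Proof.
split.
- move=> a v w; apply: ell2_eq => l.
  rewrite [RHS](_ : _ = a * B v l + B w l)%R// !BE.
  have hs u : norm1 (fun j => dot (u : ell2 R s) (y j) * y j l)%R < +oo.
    by have [+ _] := norm1_tsum (norm1_rank1_lty (ell2_norminf_lty u)); exact.
  rewrite -tsumZ// -tsumD//; last by rewrite norm1Z lte_mul_pinfty ?lee_fin ?modulus_ge0.
  congr tsum; apply/funext => j.
  have av : norminf (fun k => a * v k)%R < +oo by exact: (ell2_norminf_lty (a *: v)%R).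
  rewrite mulrA -mulrDl; congr (_ * _)%R.
  rewrite -dotZl; last by rewrite dot_summable ?ell2_norminf_lty ?ell1_lty.
  by rewrite -dotDl ?ell2_norminf_lty ?ell1_lty.
- apply: le_lt_trans hy; apply: ge_ereal_sup => _ [v /= v1 <-].
  apply: le_trans (norm2_le_norm1 _) _; apply: le_trans (rank1_series_norm1 v) _.
  rewrite -[leRHS]mul1e lee_wpmul2r//.
    by apply: nneseries_ge0 => *; rewrite expe2 mule_ge0 ?norm1_ge0.
  exact: le_trans (norminf_le_norm2 _) v1.
- move=> v w.
  (* [B w] is summable, so [dot v (B w)] pairs a bounded with a summable sequence and conjugate
     symmetry applies. *)
  have hw : norm1 (B w) < +oo.
    by apply: le_lt_trans (rank1_series_norm1 w) _; exact: norminf_mul_lty (ell2_norminf_lty w) hy.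
  rewrite [RHS](_ : _ = conjs (dot (B w) v)); last first.
    by rewrite (@dotC _ _ v (B w)) ?conjsK ?ell2_norminf_lty.
  rewrite !rank1_series_dot -tsum_conjs; last exact: rank1_series_dot_summable.
  by congr tsum; apply/funext => j; rewrite conjsM conjsK mulrC.
- move=> v; rewrite rank1_series_dot; apply: tsum_ge0; first exact: rank1_series_dot_summable.
  by move=> j; exact: mul_conjs_ge0.
- exact: le_lt_trans rank1_series_norm11 hy.
Qed.

End rank_one_series.

(** * Conjugation of a strong sum by [T] *)

Section conjugation.
Context {R : realType} {s : scalars}.
Local Notation K := (scalar_field R s).
Local Open Scope ereal_scope.

Lemma opnorm1_sum_sqr (T : {linear ell1 R s -> ell1 R s}) (x : nat -> ell1 R s) :
  opnorm1 T < +oo ->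
  \sum_(j <oo) norm1 (T (x j)) ^+ 2 <= opnorm1 T ^+ 2 * \sum_(j <oo) norm1 (x j) ^+ 2.
Proof.
move=> hT; have Tfin : opnorm1 T \is a fin_num by rewrite ge0_fin_numE ?opnorm1_ge0.
rewrite -(fineK Tfin) -EFin_expe -nneseriesZl; last first.
  by move=> *; rewrite expe2 mule_ge0 ?norm1_ge0.
apply: lee_nneseries => j *; first by rewrite expe2 mule_ge0 ?norm1_ge0.
by rewrite EFin_expe fineK// !expe2 muleACA lee_pmul ?norm1_ge0 ?le_opnorm1.
Qed.

Lemma strong_sum_conj_op (T : {linear ell1 R s -> ell1 R s}) (A : ell2 R s -> ell2 R s)
    (x : nat -> ell1 R s) :
  opnorm1 T < +oo -> norm11 A < +oo -> \sum_(j <oo) norm1 (x j) ^+ 2 < +oo ->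
  strong_sum (fun j => rank1 (x j)) A ->
  forall v l, conj_op T A v l = tsum (fun j => dot v (T (x j)) * T (x j) l)%R.
Proof.
move=> hT hA hx /(strong_sum_rank1P hx) AE v l.
set b := adjoint T (ell2_ellinf v).
have hb := ellinf_lty b.
(* The expansion of [A] is given on [ell2] only. For the bounded sequence [b] it is rebuilt from the
   columns [A (delta i)] by exchanging the sums over [i] and [j]. *)
have Y k : ellinf_ell1 A b k = tsum (fun j => dot b (x j) * x j k)%R.
  rewrite ellinf_ell1E//.
  pose F j i : K := (x j k * (b i * conjs (x j i)))%R.
  have hF : \sum_(j <oo) norm1 (F j) < +oo.
    apply: le_lt_trans (norminf_mul_lty hb hx).
    rewrite -norminfZ_nneseries//; last by move=> *; rewrite expe2 mule_ge0 ?norm1_ge0.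
    apply: lee_nneseries => j *; first exact: norm1_ge0.
    rewrite norm1Z expe2 muleCA lee_pmul ?lee_fin ?modulus_ge0 ?norm1_ge0 ?le_modulus_norm1//.
    by rewrite -[norm1 (x j)]norm1_conjs; exact: norm1_mul.
  transitivity (tsum (fun i => tsum (fun j => F j i))).
    congr tsum; apply/funext => i; rewrite AE -tsumZ.
      by congr tsum; apply/funext => j; rewrite dot_deltal /F mulrA mulrC.
    by have [+ _] := norm1_tsum (norm1_rank1_lty hx (ell2_norminf_lty (delta i))); exact.
  rewrite tsum_exchange//; congr tsum; apply/funext => j.
  by rewrite /F tsumZ ?dot_summable ?ell1_lty// mulrC.
rewrite /conj_op/= -/b.
rewrite (@linear_tsum _ _ T (fun j => dot b (x j) *: x j)%R _ hT _ Y)//; last first.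
  exact: norm1_rank1_lty hx _ hb.
congr tsum; apply/funext => j.
have E : dot b (x j) = dot v (T (x j)) := adjointP hT (ell2_ellinf v) (x j).
by rewrite -E linearZ.
Qed.

End conjugation.

(** * The estimate of [gamma_plus] through near-optimal representations *)

Local Open Scope ereal_scope.

Theorem lemma5p13 (R : realType) (s : scalars)
    (T : {linear ell1 R s -> ell1 R s}) (A : ell2 R s -> ell2 R s) :
  opnorm1 T < +oo -> Gamma_plus A ->
  Gamma_plus (conj_op T A) /\
  gamma_plus (conj_op T A) <= gamma_plus A * opnorm1 T ^+ 2.
Proof.
move=> hT [[_ _ _ _ hA] gA].
have Tfin : opnorm1 T \is a fin_num by rewrite ge0_fin_numE ?opnorm1_ge0.
have g0 : 0 <= gamma_plus A.
  apply: le_ereal_inf_tmp => _ [x _ <-].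
  by apply: nneseries_ge0 => *; rewrite expe2 mule_ge0 ?norm1_ge0.
have gfin : gamma_plus A \is a fin_num by rewrite ge0_fin_numE.
(* The infimum need not be attained, so a representation of [A] within [e] of it is transported by
   [T]. *)
have key (e : R) : (0 < e)%R -> Gamma (conj_op T A) /\
    gamma_plus (conj_op T A) <= opnorm1 T ^+ 2 * (gamma_plus A + e%:E).
  move=> e0.
  have [_ [x hx <-] xlt] := lb_ereal_inf_adherent e0 gfin.
  have xlty : \sum_(j <oo) norm1 (x j) ^+ 2 < +oo.
    by apply: lt_trans xlt _; rewrite -/(gamma_plus A) -(fineK gfin) -EFinD ltry.
  have TxE := strong_sum_conj_op hT hA xlty hx.
  have Tle := opnorm1_sum_sqr x hT.
  have Tx : \sum_(j <oo) norm1 (T (x j)) ^+ 2 < +oo.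
    apply: le_lt_trans Tle _.
    by rewrite -(fineK Tfin) -EFin_expe lte_mul_pinfty ?lee_fin ?sqr_ge0.
  split; first exact: rank1_series_Gamma Tx _ TxE.
  apply: (@le_trans _ _ (\sum_(j <oo) norm1 (T (x j)) ^+ 2)).
    apply: ereal_inf_lbound; exists (T \o x) => //=.
    exact/(strong_sum_rank1P Tx).
  apply: le_trans Tle _; rewrite lee_wpmul2l ?sqre_ge0//.
  exact: ltW.
(* Any single representation of finite cost gives membership in [Gamma]; the tolerance 1 is
   arbitrary. *)
have [GT _] := key 1%R ltr01.
have gle : gamma_plus (conj_op T A) <= gamma_plus A * opnorm1 T ^+ 2.
  apply/lee_addgt0Pr => e e0.
  have [r rE] : exists r, opnorm1 T = r%:E by exists (fine (opnorm1 T)); rewrite fineK.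
  have [g gE] : exists g, gamma_plus A = g%:E by exists (fine (gamma_plus A)); rewrite fineK.
  have r0 : (0 < r ^+ 2 + 1)%R by rewrite ltr_wpDl ?sqr_ge0.
  (* The error is multiplied by [r ^+ 2], so this tolerance keeps it below [e]; adding 1 keeps the
     denominator positive when [T] vanishes. *)
  have [_] := key (e / (r ^+ 2 + 1))%R (divr_gt0 e0 r0).
  move=> /le_trans; apply; rewrite rE gE -!EFin_expe -EFinD -!EFinM -EFinD lee_fin.
  rewrite mulrDr (mulrC g) lerD2l mulrCA -[leRHS]mulr1 ler_wpM2l ?(ltW e0)//.
  by rewrite ler_pdivrMr// mul1r lerDl.
have glty : gamma_plus (conj_op T A) < +oo.
  apply: le_lt_trans gle _.
  by rewrite -(fineK gfin) -(fineK Tfin) -EFin_expe -EFinM ltry.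
exact: (conj (conj GT glty) gle).
Qed.
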